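(* Let $A\in\mathbb{R}^{n\times n}$ and let $A U = U T + u\, b^T$ be a randomized Krylov-Schur factorization of order $k$. Let $1\le q<k$ and partition it (without splitting a $2\times2$ diagonal block of $T$) as $$A (U_q \; \tilde{U}) = (U_q \; \tilde{U})\begin{pmatrix} T_{qq} & * \\ 0 & \tilde{T}\end{pmatrix} + u\,(b_q^T \; \tilde{b}^T),$$ where $U_q\in\mathbb{R}^{n\times q}$ and the spectrum of $T_{qq}$ is $(\lambda_1,\dots,\lambda_q)$. Let $P_{U_q}^{\Omega}=U_q(\Omega U_q)^\dagger\Omega$, an oblique projector onto $\operatorname{span}\{U_q\}$, and $A_q=(I-P_{U_q}^{\Omega})A$. If the first $q$ components of $b$ are zero, i.e. $b_q^T=(0,\dots,0)$, then the sketch-orthonormal set of vectors $U_q$ can be deflated using the decomposition $$(I-P_{U_q}^{\Omega})A\tilde U=\tilde U\tilde T+u\,\tilde b^T .$$ Moreover: 1. $(\lambda_1,\dots,\lambda_q)$ are eigenvalues of $A$, and the columns of $U_q$ are sketch-orthonormal Schur vectors of $A$ spanning the invariant subspace associated with these eigenvalues, i.e. $AU_q=U_qT_{qq}$. 2. Let $(\lambda_1,\dots,\lambda_q,\lambda_{q+1},\dots,\lambda_k)$ be any subset of eigenvalues of $A$ (closed under conjugation, counted with multiplicity) containing $(\lambda_1,\dots,\lambda_q)$. This subset has an associated $k$-partial sketch-orthonormal real Schur factorization $AU'=U'T'$ of $A$ whose first $q$ columns are $U_q$. The operator $A_q$ shares the same sketch-orthonormal Schur vectors $U'$ as in that factorization,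 now associated with the eigenvalues $(0,\dots,0,\lambda_{q+1},\dots,\lambda_k)$. 3. Reciprocally, if the columns of $U_r\in\mathbb{R}^{n\times r}$, $r\le k-q$, are $r$ sketch-orthonormal Schur vectors for $A_q$ associated with nonzero eigenvalues, then the columns of $(U_q\;U_r)$ are sketch-orthonormal Schur vectors for $A$, and as such their span is invariant under $A$.
   Context: The span of a matrix is the span of its columns, and $\mathcal{K}_j(A,v)=\operatorname{span}\{v,Av,\dots,A^{j-1}v\}$. For a subspace $\mathcal{S}\subset\mathbb{R}^n$ and $\epsilon\in[0,1)$, $\Omega\in\mathbb{R}^{d\times n}$ is an $\epsilon$-embedding for $\mathcal{S}$ if $(1-\epsilon)\|x\|^2\le\|\Omega x\|^2\le(1+\epsilon)\|x\|^2$ for all $x\in\mathcal{S}$. A matrix $M$ is sketch-orthonormal if $(\Omega M)^T(\Omega M)=I$. $\Omega$ is assumed to be an $\epsilon$-embedding for every subspace in which a sketch-orthonormal basis is formed: for $\operatorname{span}\{U\;u\}$ and, in item 2, for the $k$-dimensional $A$-invariant subspace containing $\operatorname{span}\{U_q\}$ which is associated with the chosen eigenvalues. Randomized Krylov-Schur factorization of order $k$: $AU=UT+u b^T$ with $T\in\mathbb{R}^{k\times k}$ of rank $k$ and block upper-triangular (diagonal blocks of size $1\times1$, or $2\times2$ for complex conjugate pairs of eigenvalues), and $(U\;u)\in\mathbb{R}^{n\times(k+1)}$ a sketch-orthonormal basis of a Krylov subspace $\mathcal{K}_{k+1}(A,v_1)$. An $m$-partial sketch-orthonormal real Schur factorization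 of a matrix $M$ is $MW=WS$ with $W\in\mathbb{R}^{n\times m}$ sketch-orthonormal and $S\in\mathbb{R}^{m\times m}$ block upper triangular with diagonal blocks of dimension up to $2\times2$; the columns of $W$ are then called sketch-orthonormal Schur vectors of $M$, associated with the eigenvalues of $S$. *)

(* Defs.v *)
From HB Require Import structures.
From mathcomp Require Import all_boot all_order all_algebra.
From mathcomp Require Import reals.
From mathcomp Require Export complex.

Set Implicit Arguments.
Unset Strict Implicit.
Unset Printing Implicit Defensive.

Import Order.TTheory GRing.Theory Num.Theory.
Local Open Scope ring_scope.

Definition colspan (R : fieldType) n m (M : 'M[R]_(n, m)) : {vspace 'cV[R]_n} :=
  <<[seq col j M | j <- enum 'I_m]>>%VS.

Definition krylov (R : fieldType) n (A : 'M[R]_n) (v : 'cV[R]_n) (j : nat) :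
    {vspace 'cV[R]_n} :=
  <<[seq A ^+ i *m v | i <- iota 0 j]>>%VS.

Definition invariant_under (R : fieldType) n (A : 'M[R]_n)
    (V : {vspace 'cV[R]_n}) : Prop :=
  forall x, x \in V -> A *m x \in V.

(* The norm that MathComp-Analysis puts on matrices is the sup norm. *)
Definition sqnorm (R : realType) n (x : 'cV[R]_n) : R := \sum_i x i 0 ^+ 2.

Definition eps_embedding (R : realType) d n (eps : R) (Omega : 'M[R]_(d, n))
    (V : {vspace 'cV[R]_n}) : Prop :=
  forall x, x \in V ->
    (1 - eps) * sqnorm x <= sqnorm (Omega *m x) <= (1 + eps) * sqnorm x.

Definition sketch_orthonormal (R : realType) d n m (Omega : 'M[R]_(d, n))
    (M : 'M[R]_(n, m)) : Prop :=
  (Omega *m M)^T *m (Omega *m M) = 1%:M.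

Definition penrose (R : realType) m n (X : 'M[R]_(m, n)) : pred 'M[R]_(n, m) :=
  fun Y => [&& X *m Y *m X == X, Y *m X *m Y == Y,
               (X *m Y)^T == X *m Y & (Y *m X)^T == Y *m X].

Lemma row_free_gram_unit (R : realType) m n (X : 'M[R]_(m, n)) :
  row_free X -> X *m X^T \in unitmx.
Proof.
move=> freeX; rewrite -row_free_unit; apply: inj_row_free => v vXX0.
apply: (row_free_inj freeX); rewrite mul0mx.
have : (v *m X) *m (v *m X)^T = 0 by rewrite trmx_mul mulmxA -(mulmxA v) vXX0 mul0mx.
move=> /matrixP /(_ 0 0); rewrite !mxE => /psumr_eq0P s0.
apply/matrixP => i j; rewrite ord1 [RHS]mxE.
have /eqP : (v *m X) 0 j * (v *m X)^T j 0 = 0.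
  by apply: s0 => // k _; rewrite [_^T _ _]mxE -expr2 sqr_ge0.
by rewrite [_^T _ _]mxE mulf_eq0 orbb => /eqP.
Qed.

Lemma penrose_exists (R : realType) m n (X : 'M[R]_(m, n)) :
  exists Y, penrose X Y.
Proof.
have [r [C [F [uC uF EX]]]] : exists r (C : 'M[R]_(m, r)) (F : 'M[R]_(r, n)),
    [/\ C^T *m C \in unitmx, F *m F^T \in unitmx & X = C *m F].
  exists (\rank X), (col_base X), (row_base X); split.
  - rewrite -{2}[col_base X]trmxK; apply: row_free_gram_unit.
    by rewrite /row_free mxrank_tr; exact: col_base_full.
  - exact/row_free_gram_unit/row_base_free.
  - by rewrite mulmx_base.
pose Y := F^T *m invmx (F *m F^T) *m (invmx (C^T *m C) *m C^T).
have KF k (M : 'M_(r, k)) : F *m (F^T *m (invmx (F *m F^T) *m M)) = M.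
  by rewrite (mulmxA F) mulKVmx.
have KC k (M : 'M_(r, k)) : invmx (C^T *m C) *m (C^T *m (C *m M)) = M.
  by rewrite (mulmxA C^T) mulKmx.
have XY : X *m Y = C *m (invmx (C^T *m C) *m C^T).
  by rewrite EX /Y -!mulmxA KF.
have YX : Y *m X = F^T *m (invmx (F *m F^T) *m F).
  by rewrite EX /Y -!mulmxA KC.
exists Y; apply/and4P; split; apply/eqP.
- by rewrite XY EX -!mulmxA KC.
- by rewrite YX /Y -!mulmxA KF.
- by rewrite XY !trmx_mul trmxK trmx_inv trmx_mul trmxK mulmxA.
- by rewrite YX !trmx_mul trmxK trmx_inv trmx_mul trmxK mulmxA.
Qed.

Definition pinv (R : realType) m n (X : 'M[R]_(m, n)) : 'M[R]_(n, m) :=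
  xchoose (penrose_exists X).

Lemma pinvP (R : realType) m n (X : 'M[R]_(m, n)) : penrose X (pinv X).
Proof. exact: xchooseP. Qed.

Lemma penrose_uniq (R : realType) m n (X : 'M[R]_(m, n)) Y Z :
  penrose X Y -> penrose X Z -> Y = Z.
Proof.
move=> /and4P[/eqP y1 /eqP y2 /eqP y3 /eqP y4].
move=> /and4P[/eqP z1 /eqP z2 /eqP z3 /eqP z4].
have XYZ : X *m Y = X *m Z.
  by rewrite -y3 -[in LHS]z1 -(mulmxA (X *m Z)) trmx_mul y3 z3 !mulmxA y1.
have YZX : Y *m X = Z *m X.
  by rewrite -y4 -[in LHS]z1 !mulmxA -(mulmxA (Y *m X)) trmx_mul y4 z4
    -mulmxA (mulmxA X) y1.
by rewrite -y2 YZX -mulmxA XYZ mulmxA z2.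
Qed.

Definition oblique_proj (R : realType) d n q (Omega : 'M[R]_(d, n))
    (Uq : 'M[R]_(n, q)) : 'M[R]_n :=
  Uq *m pinv (Omega *m Uq) *m Omega.

Definition complexify (R : realType) m n (M : 'M[R]_(m, n)) : 'M[R[i]]_(m, n) :=
  map_mx (real_complex R) M.

Definition has_spectrum (R : realType) m (M : 'M[R]_m) (s : seq R[i]) : Prop :=
  char_poly (complexify M) = \prod_(l <- s) ('X - l%:P).

Definition eigenvalue_subset (R : realType) m (M : 'M[R]_m) (s : seq R[i]) : Prop :=
  exists s', has_spectrum M (s ++ s').

Definition conj_closed (R : realType) (s : seq R[i]) : bool :=
  perm_eq [seq conjc l | l <- s] s.

(* [M] below is the matrix of the restriction of [A] to [V] in the basis given
   by the columns of [X]. *)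
Definition assoc_invariant_subspace (R : realType) n (A : 'M[R]_n) (k : nat)
    (V : {vspace 'cV[R]_n}) (s : seq R[i]) : Prop :=
  [/\ invariant_under A V, \dim V = k &
      exists (X : 'M[R]_(n, k)) (M : 'M[R]_k),
        [/\ colspan X = V, A *m X = X *m M & has_spectrum M s]].

(* [sh] lists the sizes of the diagonal blocks; [reshape_index sh i] is the
   number of the block containing the index [i]. *)
Definition block_upper_triangular (R : realType) (sh : seq nat) m
    (T : 'M[R]_m) : Prop :=
  sumn sh = m /\
  forall i j : 'I_m, (reshape_index sh j < reshape_index sh i)%N -> T i j = 0.

Definition blocks_upto2 (sh : seq nat) : bool := all (mem [:: 1; 2]%N) sh.

Definition partial_schur (R : realType) d n m (Omega : 'M[R]_(d, n))
    (M : 'M[R]_n) (W : 'M[R]_(n, m)) (S : 'M[R]_m) : Prop :=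
  [/\ M *m W = W *m S, sketch_orthonormal Omega W &
      exists2 sh, blocks_upto2 sh & block_upper_triangular sh S].

Definition schur_vectors (R : realType) d n m (Omega : 'M[R]_(d, n))
    (M : 'M[R]_n) (W : 'M[R]_(n, m)) : Prop :=
  exists S, partial_schur Omega M W S.

Definition schur_vectors_for (R : realType) d n m (Omega : 'M[R]_(d, n))
    (M : 'M[R]_n) (W : 'M[R]_(n, m)) (s : seq R[i]) : Prop :=
  exists2 S, partial_schur Omega M W S & has_spectrum S s.

(* An injective [f] whose two values lie in the same block of [sh] enumerates
   the indices of a 2 x 2 diagonal block. *)
Definition conj_pair_blocks (R : realType) (sh : seq nat) m (T : 'M[R]_m) : Prop :=
  forall f : 'I_2 -> 'I_m, injective f ->
    reshape_index sh (f ord0) = reshape_index sh (f ord_max) ->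
    exists2 z : R[i], complex.Im z != 0 & has_spectrum (mxsub f f T) [:: z; conjc z].

Record krylov_schur (R : realType) d n k (Omega : 'M[R]_(d, n)) (A : 'M[R]_n)
    (sh : seq nat) (U : 'M[R]_(n, k)) (T : 'M[R]_k) (u : 'cV[R]_n)
    (b : 'cV[R]_k) : Prop := KrylovSchur {
  ks_eq : A *m U = U *m T + u *m b^T;
  ks_rank : \rank T = k;
  ks_blocks : blocks_upto2 sh;
  ks_triangular : block_upper_triangular sh T;
  ks_conj_pairs : conj_pair_blocks sh T;
  ks_orthonormal : sketch_orthonormal Omega (row_mx U u);
  ks_krylov : exists v1, colspan (row_mx U u) = krylov A v1 k.+1
}.

(* Main.v *)
Require Import Defs.
From HB Require Import structures.
From mathcomp Require Import all_boot all_order all_algebra.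
From mathcomp Require Import reals complex.
From mathcomp Require Import ring.

Set Implicit Arguments.
Unset Strict Implicit.
Unset Printing Implicit Defensive.

Import Order.TTheory GRing.Theory Num.Theory.
Local Open Scope ring_scope.

(** Since [b_q = 0], the first block column of the Krylov-Schur relation says
    that [Uq] spans an [A]-invariant subspace.  In any basis that extends [Uq],
    [A] is block upper triangular with diagonal blocks [Tqq] and [B], so
    characteristic polynomials factor, and replacing [A] by [(I - P) A] clears
    the first block row and leaves [B] unchanged.

    Any conjugation-closed part of the spectrum of a real matrix is realized by
    an orthonormal real Schur form: the real and imaginary parts of an
    eigenvector span an invariant subspace of dimension 1 or 2, which is
    orthonormalized and split off.  Applied to [B] it gives item 2.  For item 3,
    [W = (I - P) A W S^-1] forces [P W = 0] as soon as [S] is invertible. *)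

(** * Characteristic polynomials and matrices of full column rank *)

(** The determinant of [G] is a nonzero constant polynomial, so it cancels after taking determinants
    in [(X - A) G = G (X - B)]. *)
Lemma char_poly_intertwine (F : fieldType) n (A B G : 'M[F]_n) :
  G \in unitmx -> A *m G = G *m B -> char_poly A = char_poly B.
Proof.
move=> uG AG; have detG : \det (map_mx (@polyC F) G) != 0.
  by rewrite det_map_mx polyC_eq0 -unitfE -unitmxE.
apply: (mulIf detG); rewrite /char_poly [RHS]mulrC -!det_mulmx; congr (\det _).
by rewrite /char_poly_mx mulmxBl mulmxBr -!map_mxM AG scalar_mxC.
Qed.

Lemma char_poly_ublock (F : fieldType) n1 n2 (A : 'M[F]_n1) (N : 'M_(n1, n2))
    (B : 'M_n2) :
  char_poly (block_mx A N 0 B) = char_poly A * char_poly B.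
Proof.
rewrite /char_poly -(det_ublock _ (- map_mx (@polyC F) N)); congr (\det _).
rewrite /char_poly_mx map_block_mx map_mx0 scalar_mx_block opp_block_mx.
by rewrite add_block_mx oppr0 addr0 add0r.
Qed.

Lemma row_full_mul (F : fieldType) m n p (M : 'M[F]_(m, n)) (G : 'M_(n, p)) :
  row_full M -> row_full G -> row_full (M *m G).
Proof.
move=> /row_fullP[L LM] /row_fullP[K KG]; apply/row_fullP; exists (K *m L).
by rewrite -mulmxA (mulmxA L) LM mul1mx.
Qed.

Lemma row_full_lsub (F : fieldType) m n1 n2 (M1 : 'M[F]_(m, n1)) (M2 : 'M_(m, n2)) :
  row_full (row_mx M1 M2) -> row_full M1.
Proof.
move=> /row_fullP[L]; rewrite -[L]vsubmxK mul_col_row scalar_mx_block.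
by move=> /eq_block_mx[LM _ _ _]; apply/row_fullP; exists (usubmx L).
Qed.

Lemma row_full_rsub (F : fieldType) m n1 n2 (M1 : 'M[F]_(m, n1)) (M2 : 'M_(m, n2)) :
  row_full (row_mx M1 M2) -> row_full M2.
Proof.
move=> /row_fullP[L]; rewrite -[L]vsubmxK mul_col_row scalar_mx_block.
by move=> /eq_block_mx[_ _ _ LM]; apply/row_fullP; exists (dsubmx L).
Qed.

Lemma ublock_unit (F : fieldType) n1 n2 (A : 'M[F]_n1) (N : 'M_(n1, n2)) B :
  (block_mx A N 0 B \in unitmx) = (A \in unitmx) && (B \in unitmx).
Proof. by rewrite !unitmxE det_ublock unitrM. Qed.

Lemma row_full_inj0 (F : fieldType) m n (M : 'M[F]_(m, n)) :
  (forall x : 'cV_n, M *m x = 0 -> x = 0) -> row_full M.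
Proof.
move=> M0; rewrite -[M]trmxK /row_full mxrank_tr -/(row_free _).
apply: inj_row_free => v /(congr1 trmx); rewrite trmx_mul trmxK trmx0 => /M0.
by move/(congr1 trmx); rewrite trmxK trmx0.
Qed.

(** * Orthonormalization *)

Section Orthonormalization.
Variable R : realType.

Lemma gram_unit m n (M : 'M[R]_(m, n)) : row_full M -> M^T *m M \in unitmx.
Proof.
move=> fM; rewrite -{2}[M]trmxK; apply: row_free_gram_unit.
by rewrite /row_free mxrank_tr.
Qed.

Lemma orthonormal_row_full m n (M : 'M[R]_(m, n)) : M^T *m M = 1%:M -> row_full M.
Proof. by move=> MM; apply/row_fullP; exists M^T. Qed.

Lemma gram_row m n1 n2 (M1 : 'M[R]_(m, n1)) (M2 : 'M_(m, n2)) :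
  (row_mx M1 M2)^T *m row_mx M1 M2 = 1%:M <->
  [/\ M1^T *m M1 = 1%:M, M2^T *m M2 = 1%:M & M1^T *m M2 = 0].
Proof.
rewrite tr_row_mx mul_col_row scalar_mx_block; split.
  by move=> /eq_block_mx[].
move=> [-> -> M12]; rewrite M12; congr block_mx.
by rewrite -(trmxK M1) -trmx_mul M12 trmx0.
Qed.

(** Subtracting from [M2] its orthogonal projection onto the columns of [M1] is a unipotent change
    of basis, hence preserves independence. *)
Lemma orthogonal_split m n1 n2 (M1 : 'M[R]_(m, n1)) (M2 : 'M_(m, n2)) :
  M1^T *m M1 = 1%:M -> row_full (row_mx M1 M2) ->
  exists K, M1^T *m (M1 *m K + M2) = 0 /\ row_full (M1 *m K + M2)%R.
Proof.
move=> M11 fM; exists (- (M1^T *m M2)); split.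
  by rewrite mulmxDr mulmxA M11 mul1mx addNr.
pose G := block_mx 1%:M (- (M1^T *m M2)) 0 1%:M : 'M[R]_(n1 + n2).
have uG : G \in unitmx by rewrite ublock_unit !unitmx1.
rewrite -row_full_unit in uG; have := row_full_mul fM uG.
by rewrite mul_row_block mulmx0 !mulmx1 addr0 => /row_full_rsub.
Qed.

(** Here [M] takes the place of the sketch: the conclusion makes the columns of [M *m C]
    orthonormal. The induction normalizes the first column, makes the others orthogonal to it and
    recurses on them. *)
Lemma gram_schmidt m n (M : 'M[R]_(m, n)) :
  row_full M -> exists2 C, C \in unitmx & sketch_orthonormal M C.
Proof.
rewrite /sketch_orthonormal; elim: n M => [|n IHn].
  by move=> M _; exists 1%:M; rewrite ?unitmx1 // [LHS]flatmx0 [RHS]flatmx0.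
rewrite -[n.+1]/(1 + n)%N => M fM; rewrite -[M]hsubmxK in fM *.
move: (lsubmx M) (rsubmx M) fM => a M' fM.
have ua := gram_unit (row_full_lsub fM).
have [s aa] : exists s, a^T *m a = s%:M by eexists; exact: mx11_scalar.
have s_gt0 : 0 < s.
  rewrite lt_def; apply/andP; split.
    by move: ua; rewrite aa unitmxE det_scalar1 unitfE.
  move/matrixP: aa => /(_ 0 0); rewrite !mxE eqxx mulr1n => <-.
  by apply: sumr_ge0 => i _; rewrite mxE -expr2 sqr_ge0.
pose t := (Num.sqrt s)^-1.
have tts : t * t * s = 1.
  by rewrite -invfM -expr2 sqr_sqrtr ?ltW // mulVf // gt_eqF.
have t_neq0 : t != 0.
  by apply/eqP => t0; move: tts; rewrite t0 !mul0r => /esym/eqP; rewrite oner_eq0.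
have ut : t%:M \in @unitmx R 1 by rewrite unitmxE det_scalar1 unitfE.
have ee : (a *m t%:M)^T *m (a *m t%:M) = 1%:M.
  by rewrite mul_mx_scalar -scalemxAr linearZ /= -scalemxAl aa scalerA
    scale_scalar_mx tts.
have fe : row_full (row_mx (a *m t%:M) M').
  have -> : row_mx (a *m t%:M) M' = row_mx a M' *m block_mx t%:M 0 0 1%:M.
    by rewrite mul_row_block !mulmx0 mulmx1 addr0 add0r.
  by apply: row_full_mul fM _; rewrite row_full_unit ublock_unit ut unitmx1.
have [K [eK fK]] := orthogonal_split ee fe.
have [C uC CC] := IHn _ fK.
exists (block_mx t%:M (t%:M *m K *m C) 0 C); first by rewrite ublock_unit ut.
rewrite mul_row_block mulmx0 addr0 !mulmxA -mulmxDl; apply/gram_row; split=> //.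
by rewrite mulmxA eK mul0mx.
Qed.

(** The identity block leaves [M1] untouched, so that given Schur vectors can be extended rather
    than replaced. *)
Lemma orthonormal_extension m n1 n2 (M1 : 'M[R]_(m, n1)) (M2 : 'M_(m, n2)) :
  M1^T *m M1 = 1%:M -> row_full (row_mx M1 M2) ->
  exists K C, C \in unitmx /\ sketch_orthonormal (row_mx M1 M2) (block_mx 1%:M K 0 C).
Proof.
move=> M11 fM; have [K [K0 fK]] := orthogonal_split M11 fM.
have [C uC CC] := gram_schmidt fK.
exists (K *m C), C; split=> //.
rewrite /sketch_orthonormal mul_row_block mulmx0 addr0 mulmx1 mulmxA -mulmxDl.
by apply/gram_row; split=> //; rewrite mulmxA K0 mul0mx.
Qed.

(** [Z] is an orthonormal basis of the kernel of [X^T]. Multiplying a relation [X a + Z b = 0] by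
    [X^T] and then by [Z^T] gives [a = 0] and [b = 0]. *)
Lemma orthogonal_completion n1 n2 (X : 'M[R]_(n1 + n2, n1)) :
  row_full X ->
  exists Z : 'M_(n1 + n2, n2),
    [/\ X^T *m Z = 0, Z^T *m Z = 1%:M & row_mx X Z \in unitmx].
Proof.
move=> fX; have [Z0 fZ0 XZ0] : exists2 Z0 : 'M_(n1 + n2, n2),
    row_full Z0 & X^T *m Z0 = 0.
  have rk : \rank (kermx X) = n2 by rewrite mxrank_ker (eqP fX) addKn.
  have : exists2 N : 'M_(\rank (kermx X), n1 + n2), row_free N & N *m X = 0.
    exists (row_base (kermx X)); first exact: row_base_free.
    by apply/sub_kermxP; rewrite eq_row_base.
  rewrite rk => -[N fN NX]; exists N^T; first by rewrite /row_full mxrank_tr.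
  by rewrite -trmx_mul NX trmx0.
have [C uC CC] := gram_schmidt fZ0.
exists (Z0 *m C); split=> //; first by rewrite mulmxA XZ0 mul0mx.
rewrite -row_full_unit; apply: row_full_inj0 => x.
rewrite -[x]vsubmxK mul_row_col => E.
have x1 : usubmx x = 0.
  have := congr1 (mulmx X^T) E; rewrite mulmxDr !mulmxA XZ0 !mul0mx addr0 mulmx0.
  by move/(congr1 (mulmx (invmx (X^T *m X)))); rewrite mulKmx ?gram_unit // mulmx0.
rewrite x1 mulmx0 add0r in E; rewrite x1.
have := congr1 (mulmx (Z0 *m C)^T) E.
by rewrite mulmxA CC mul1mx mulmx0 => ->; rewrite col_mx0.
Qed.

End Orthonormalization.

(** * Block triangular form along an invariant subspace *)

Section InvariantBlocks.
Variable F : fieldType.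

(** Both [lsubmx M] and [col_mx C 0] hold the coordinates of [A *m U1] in one independent family, so
    they agree. *)
Lemma lsub_invariant n n1 n2 (A : 'M[F]_n) (U1 : 'M_(n, n1)) (U2 : 'M_(n, n2))
    (C : 'M_n1) (M : 'M_(n1 + n2)) :
  row_full (row_mx U1 U2) -> A *m row_mx U1 U2 = row_mx U1 U2 *m M ->
  A *m U1 = U1 *m C -> M = block_mx C (ursubmx M) 0 (drsubmx M).
Proof.
move=> fU AU AU1.
suff : lsubmx M = col_mx C 0.
  move=> E; rewrite -[LHS]hsubmxK E -[rsubmx M]vsubmxK -block_mxEh.
  by congr block_mx; apply/matrixP => i j; rewrite !mxE.
apply: (row_full_inj fU); rewrite mul_row_col mulmx0 addr0 -AU1.
have := congr1 lsubmx AU; rewrite mul_mx_row row_mxKl => ->.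
by rewrite -{2}[M]hsubmxK mul_mx_row row_mxKl.
Qed.

End InvariantBlocks.

(** In the basis [(X Z)] the operator is block upper triangular; [B] represents [A] on the quotient
    by the span of [X] and carries the rest of the spectrum. *)
Lemma deflation (R : realType) n1 n2 (A : 'M[R]_(n1 + n2)) (X : 'M_(n1 + n2, n1)) C :
  row_full X -> A *m X = X *m C ->
  exists (Z : 'M_(n1 + n2, n2)) N B,
    [/\ X^T *m Z = 0, Z^T *m Z = 1%:M, row_mx X Z \in unitmx,
        A *m Z = X *m N + Z *m B & char_poly A = char_poly C * char_poly B].
Proof.
move=> fX AX; have [Z [XZ ZZ uG]] := orthogonal_completion fX.
pose M := invmx (row_mx X Z) *m A *m row_mx X Z.
have AG : A *m row_mx X Z = row_mx X Z *m M by rewrite /M !mulmxA mulmxV ?mul1mx.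
have fG : row_full (row_mx X Z) by rewrite row_full_unit.
have EM := lsub_invariant fG AG AX.
exists Z, (ursubmx M), (drsubmx M); split=> //.
  have := congr1 rsubmx AG; rewrite EM mul_mx_row mul_row_block !row_mxKr.
  by rewrite -EM.
by rewrite (char_poly_intertwine uG AG) EM char_poly_ublock -EM.
Qed.

(** * Column spans *)

Section ColumnSpan.
Variable F : fieldType.

Lemma colspan_limg n m (M : 'M[F]_(n, m)) :
  colspan M = limg (linfun (mulmx M : 'cV_m -> 'cV_n)).
Proof.
apply: subv_anti; apply/andP; split.
  apply/span_subvP => x /mapP[j _ ->]; apply/memv_imgP.
  by exists (delta_mx j 0); rewrite ?memvf // lfunE /= colE.
apply/subvP => x /memv_imgP[y _ ->]; rewrite lfunE /=.
rewrite (_ : M *m y = \sum_j y j 0 *: col j M); last first.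
  apply/colP => i; rewrite mxE summxE; apply: eq_bigr => j _.
  by rewrite !mxE mulrC.
apply: rpred_sum => j _; apply/memvZ/memv_span.
by apply: map_f; rewrite mem_enum.
Qed.

Lemma colspanP n m (M : 'M[F]_(n, m)) x :
  reflect (exists y, x = M *m y) (x \in colspan M).
Proof.
rewrite colspan_limg; apply: (iffP memv_imgP) => [[y _ ->] | [y ->]].
  by exists y; rewrite lfunE.
by exists y; rewrite ?memvf // lfunE.
Qed.

Lemma colspan_subv n m p (M : 'M[F]_(n, m)) (N : 'M_(n, p)) :
  reflect (exists K, M = N *m K) (colspan M <= colspan N)%VS.
Proof.
apply: (iffP subvP) => [sMN | [K ->] x /colspanP[y ->]]; last first.
  by apply/colspanP; exists (K *m y); rewrite mulmxA.
have colM j : exists y, col j M == N *m y.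
  have /sMN/colspanP[y Ey] : col j M \in colspan M.
    by apply/colspanP; exists (delta_mx j 0); rewrite colE.
  by exists y; apply/eqP.
exists (\matrix_(i, j) xchoose (colM j) i 0).
apply/matrixP => i j; have /eqP/colP/(_ i) := xchooseP (colM j).
by rewrite !mxE => ->; apply: eq_bigr => k _; rewrite mxE.
Qed.

Lemma colspan_mul_unit n m (M : 'M[F]_(n, m)) G :
  G \in unitmx -> colspan (M *m G) = colspan M.
Proof.
move=> uG; apply: subv_anti; apply/andP; split; apply/colspan_subv.
  by exists G.
by exists (invmx G); rewrite mulmxK.
Qed.

Lemma dim_colspan n m (M : 'M[F]_(n, m)) :
  row_full M <-> \dim (colspan M) = m.
Proof.
have := limg_ker_dim (linfun (mulmx M : 'cV_m -> 'cV_n)) fullv.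
rewrite -colspan_limg capfv dimvf /dim /= muln1 => dimM; split=> [fM | dM].
  rewrite -[RHS]dimM (eqP (_ : lker _ == 0%VS)) ?dimv0 //.
  by apply/lker0P => x y; rewrite !lfunE; exact: row_full_inj.
apply: row_full_inj0 => x Mx0.
have : x \in lker (linfun (mulmx M : 'cV_m -> 'cV_n)).
  by rewrite memv_ker lfunE /= Mx0.
move: dimM; rewrite dM => /(canRL (addnK m)); rewrite subnn => /eqP.
by rewrite dimv_eq0 => /eqP ->; rewrite memv0 => /eqP.
Qed.

Lemma invariant_colspan n m (A : 'M[F]_n) (X : 'M_(n, m)) M :
  A *m X = X *m M -> invariant_under A (colspan X).
Proof.
move=> AX x /colspanP[y ->]; apply/colspanP; exists (M *m y).
by rewrite mulmxA AX mulmxA.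
Qed.

End ColumnSpan.

Lemma assoc_colspan (R : realType) n k (A : 'M[R]_n) (X : 'M_(n, k)) M s :
  row_full X -> A *m X = X *m M -> has_spectrum M s ->
  assoc_invariant_subspace A k (colspan X) s.
Proof.
move=> fX AX specM; split; last by exists X, M.
  exact: invariant_colspan AX.
exact/dim_colspan.
Qed.

(** * Block triangular matrices *)

Section DiagonalBlocks.

Lemma reshape_index_cons r sh i :
  reshape_index (r :: sh) i =
    (if i < r then 0 else (reshape_index sh (i - r)).+1)%N.
Proof.
rewrite /reshape_index /= subn_eq0; case: ltnP => // ri.
by rewrite subSn.
Qed.

Lemma reshape_index_catl sh1 sh2 i :
  (i < sumn sh1)%N -> reshape_index (sh1 ++ sh2) i = reshape_index sh1 i.
Proof.
elim: sh1 i => //= r sh IH i lti; rewrite !reshape_index_cons.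
by case: ltnP => // ri; rewrite IH // ltn_subLR.
Qed.

Lemma reshape_index_catr sh1 sh2 i :
  reshape_index (sh1 ++ sh2) (sumn sh1 + i) = (size sh1 + reshape_index sh2 i)%N.
Proof.
elim: sh1 => //= r sh IH; rewrite reshape_index_cons ltnNge -addnA leq_addr /=.
by rewrite addKn IH.
Qed.

Variable R : realType.

Lemma block_upper_triangular_cat sh1 sh2 n1 n2 (A : 'M[R]_n1) (N : 'M_(n1, n2))
    (B : 'M_n2) :
  block_upper_triangular sh1 A -> block_upper_triangular sh2 B ->
  block_upper_triangular (sh1 ++ sh2) (block_mx A N 0 B).
Proof.
move=> [s1 TA] [s2 TB]; split; first by rewrite sumn_cat s1 s2.
subst n1 n2 => i j; rewrite -(splitK i) -(splitK j).
case: (split i) => i'; case: (split j) => j' /=.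
- by rewrite block_mxEul !reshape_index_catl //; exact: TA.
(* For a row in the first part and a column in the second, the assumed order of blocks is
   impossible. *)
- rewrite reshape_index_catr reshape_index_catl // => lt.
  have /(ltn_trans lt) := reshape_indexP (ltn_ord i').
  by rewrite ltnNge leq_addr.
- by rewrite block_mxEdl mxE.
- by rewrite block_mxEdr !reshape_index_catr ltn_add2l; exact: TB.
Qed.

Lemma block_upper_triangular_ul sh1 sh2 n1 n2 (A : 'M[R]_n1) (N : 'M_(n1, n2))
    (B : 'M_n2) :
  sumn sh1 = n1 -> block_upper_triangular (sh1 ++ sh2) (block_mx A N 0 B) ->
  block_upper_triangular sh1 A.
Proof.
move=> s1 [_ T]; split=> // i j.
have := T (lshift n2 i) (lshift n2 j).
by rewrite block_mxEul /= !reshape_index_catl ?s1.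
Qed.

Lemma block_upper_triangular1 n (A : 'M[R]_n) : block_upper_triangular [:: n] A.
Proof. by split=> [|i j]; rewrite /= ?addn0 // !reshape_index_cons !ltn_ord. Qed.

(** [B] describes [A] modulo the span of [U]. As [Omega *m Y] has orthonormal columns, multiplying
    it by a [W] that is orthonormal in the Euclidean sense, that is for the sketch [1%:M], keeps
    them orthonormal. *)
Lemma partial_schur_lift d n q p r (Omega : 'M[R]_(d, n)) (A : 'M_n)
    (U : 'M_(n, q)) C (Y : 'M_(n, p)) N B (W : 'M_(p, r)) S :
  partial_schur Omega A U C -> A *m Y = U *m N + Y *m B ->
  sketch_orthonormal Omega (row_mx U Y) -> partial_schur 1%:M B W S ->
  partial_schur Omega A (row_mx U (Y *m W)) (block_mx C (N *m W) 0 S).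
Proof.
move=> [AU oU [sh1 b1 t1]] AY oUY [BW oW [sh2 b2 t2]]; split.
- by rewrite mul_mx_row AU mul_row_block mulmx0 addr0 mulmxA AY mulmxDl
    -!mulmxA BW.
- move: oUY oW; rewrite /sketch_orthonormal mul1mx (mul_mx_row Omega U Y).
  move=> /gram_row[oU' oY UY] oW; rewrite (mul_mx_row Omega U (Y *m W)).
  apply/gram_row; split=> //; rewrite (mulmxA Omega Y W).
    by rewrite trmx_mul mulmxA -(mulmxA W^T) oY mulmx1.
  by rewrite mulmxA UY mul0mx.
- exists (sh1 ++ sh2); first by rewrite /blocks_upto2 all_cat; apply/andP.
  exact: block_upper_triangular_cat.
Qed.

End DiagonalBlocks.

(** * Spectra *)

Section Spectrum.
Variable R : realType.

Lemma has_spectrumE n (M : 'M[R]_n) s :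
  has_spectrum M s <->
  map_poly (real_complex R) (char_poly M) = \prod_(l <- s) ('X - l%:P).
Proof. by rewrite map_char_poly. Qed.

Lemma eq_has_spectrum n m (M : 'M[R]_n) (N : 'M[R]_m) s :
  char_poly M = char_poly N -> has_spectrum M s -> has_spectrum N s.
Proof. by move=> E /has_spectrumE H; apply/has_spectrumE; rewrite -E. Qed.

Lemma perm_has_spectrum n (M : 'M[R]_n) s t :
  perm_eq s t -> has_spectrum M s -> has_spectrum M t.
Proof. by move=> st; rewrite /has_spectrum (perm_big _ st). Qed.

Lemma size_spectrum n (M : 'M[R]_n) s : has_spectrum M s -> size s = n.
Proof.
move/(congr1 (fun p : {poly _} => size p)).
by rewrite size_char_poly size_prod_XsubC => -[].
Qed.

Lemma spectrum_exists n (M : 'M[R]_n) : exists s, has_spectrum M s.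
Proof.
have [s Es] := closed_field_poly_normal (char_poly (complexify M)).
exists s; rewrite /has_spectrum {1}Es.
by rewrite (monicP (char_poly_monic _)) scale1r.
Qed.

(** The converse direction cancels the monic product over [s]; this is how selected eigenvalues are
    removed from a spectrum. *)
Lemma has_spectrum_cat n n1 n2 (M : 'M[R]_n) (C : 'M[R]_n1) (B : 'M[R]_n2) s t :
  char_poly M = char_poly C * char_poly B -> has_spectrum C s ->
  has_spectrum B t <-> has_spectrum M (s ++ t).
Proof.
move=> E /has_spectrumE specC; split=> /has_spectrumE.
  by move=> specB; apply/has_spectrumE; rewrite E rmorphM /= big_cat specC specB.
rewrite E rmorphM /= big_cat specC => specM; apply/has_spectrumE.
by apply: mulfI specM; rewrite monic_neq0 // monic_prod_XsubC.
Qed.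

(** Conjugating coefficients fixes the real characteristic polynomial and conjugates its roots;
    unique factorization compares the two lists. *)
Lemma conj_closed_spectrum n (M : 'M[R]_n) s : has_spectrum M s -> conj_closed s.
Proof.
move=> specM; apply: prod_XsubC_eq; rewrite -specM.
have := congr1 (map_poly (@conjc R)) specM.
rewrite rmorph_prod big_map => E.
under eq_bigr do rewrite -map_polyXsubC /=.
rewrite -E map_char_poly -map_mx_comp.
congr char_poly; apply/matrixP => i j; rewrite !mxE.
exact: conjc_real.
Qed.

Lemma perm_conj_closed (s t : seq R[i]) :
  perm_eq s t -> conj_closed s -> conj_closed t.
Proof.
rewrite /conj_closed => st cs; apply: perm_trans (perm_trans cs st).
by rewrite perm_sym perm_map.
Qed.

Lemma conj_closed_catr (s t : seq R[i]) :
  conj_closed s -> conj_closed (s ++ t) -> conj_closed t.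
Proof.
rewrite /conj_closed map_cat => cs cst; rewrite -(perm_cat2l s).
by apply: perm_trans cst; rewrite perm_cat2r perm_sym.
Qed.

(** For an eigenvector [x + i y], the equations are the real and imaginary parts of
    [A (x + i y) = l (x + i y)]. *)
Lemma complex_eigenvector_parts n (A : 'M[R]_n) l :
  root (char_poly (complexify A)) l ->
  exists x y : 'cV[R]_n,
    [/\ (x != 0) || (y != 0), A *m x = complex.Re l *: x - complex.Im l *: y
      & A *m y = complex.Im l *: x + complex.Re l *: y].
Proof.
(* [eigenvalue] concerns row vectors, so a column eigenvector of [A] is found through the
   transpose. *)
have -> : char_poly (complexify A) = char_poly (complexify A)^T.
  rewrite /char_poly -[RHS]det_tr; congr (\det _); apply/matrixP => i j.
  by rewrite !mxE eq_sym.
rewrite -eigenvalue_root_char => /eigenvalueP[v vA v0].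
pose x := \col_i complex.Re (v 0 i); pose y := \col_i complex.Im (v 0 i).
have Av i : (complexify A *m v^T) i 0 = ((A *m x) i 0 +i* (A *m y) i 0)%C.
  rewrite !mxE; elim/big_rec3: _ => // j z2 z1 z3 _ ->.
  by rewrite !mxE; case: (v 0 j) => a b; apply/eqP; rewrite eq_complex /=
    !mul0r subr0 addr0 !eqxx.
have Alv i : ((A *m x) i 0 +i* (A *m y) i 0)%C = l * v 0 i.
  by rewrite -Av -[complexify A]trmxK -trmx_mul vA !mxE.
exists x, y; split.
- apply: contraR v0; rewrite negb_or !negbK => /andP[/eqP x0 /eqP y0].
  apply/eqP/rowP => i; move: (congr1 (fun M => fun_of_matrix M i 0) x0).
  move: (congr1 (fun M => fun_of_matrix M i 0) y0); rewrite !mxE.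
  by case: (v 0 i) => a b /= -> ->.
- apply/colP => i; move: (Alv i); rewrite 4!mxE => E.
  by have := congr1 (@complex.Re R) E; rewrite !mxE; case: l (v 0 i) {E Alv vA}
    => [a b] [c e] /= ->.
- apply/colP => i; move: (Alv i); rewrite 4!mxE => E.
  by have := congr1 (@complex.Im R) E; rewrite !mxE; case: l (v 0 i) {E Alv vA}
    => [a b] [c e] /= ->; rewrite addrC.
Qed.
End Spectrum.

(** * The partial real Schur form *)

Section RealSchur.
Variable R : realType.

Lemma has_spectrum_scalar1 (c : R) : has_spectrum (c%:M : 'M_1) [:: c%:C%C].
Proof.
by apply/has_spectrumE; rewrite big_seq1 /char_poly det_mx11 !mxE !mulr1n
  rmorphB /= map_polyX map_polyC.
Qed.

(** This block is the matrix of an operator on the real and imaginary parts of an eigenvector for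
    [a + i b]. *)
Lemma has_spectrum_rotation (a b : R) :
  has_spectrum (block_mx a%:M b%:M (- b)%:M a%:M : 'M_(1 + 1))
    [:: (a +i* b)%C; conjc (a +i* b)%C].
Proof.
rewrite /has_spectrum big_cons big_seq1.
have char1 (c : R[i]) : char_poly (c%:M : 'M_1) = 'X - c%:P.
  by rewrite /char_poly det_mx11 !mxE !mulr1n.
rewrite -!char1 -(char_poly_ublock _ (b%:C%C)%:M).
(* The first column (1, i) is a complex eigenvector for a + i b. *)
apply: (@char_poly_intertwine _ _ _ _ (block_mx 1%:M 0 ('i%C)%:M 1%:M)).
  by rewrite unitmxE det_lblock !det1 mulr1 unitr1.
rewrite /complexify map_block_mx !map_scalar_mx !mulmx_block.
rewrite !mul0mx !mulmx0 !mul1mx !mulmx1 !add0r !addr0 -!scalar_mxM -!raddfD /=.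
congr block_mx; congr (_%:M); apply/eqP; rewrite eq_complex /=;
  apply/andP; split; apply/eqP; ring.
Qed.

Lemma row_full_cV n (x : 'cV[R]_n) : x != 0 -> row_full x.
Proof.
move=> x0; apply: row_full_inj0 => c; rewrite [c]mx11_scalar mul_mx_scalar.
by move/eqP; rewrite scaler_eq0 (negPf x0) orbF => /eqP ->; rewrite raddf0.
Qed.

(** A real eigenvalue gives an invariant line; a non-real one gives an invariant plane and uses up
    its conjugate too, so the remaining list stays closed under conjugation. *)
Lemma invariant_block n (A : 'M[R]_n) mu rest :
  has_spectrum A (mu ++ rest) -> conj_closed mu -> mu != [::] ->
  exists r (X : 'M_(n, r)) C mu1 mu2,
    [/\ perm_eq mu (mu1 ++ mu2), conj_closed mu2, r = 1%N \/ r = 2%N,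
        row_full X & A *m X = X *m C /\ has_spectrum C mu1].
Proof.
case: mu => // l mu specA cmu _.
have /complex_eigenvector_parts[x [y [xy Ax Ay]]] :
  root (char_poly (complexify A)) l by rewrite specA root_prod_XsubC mem_head.
case: l specA cmu Ax Ay => a b specA cmu /= Ax Ay.
have [b0 | b0] := eqVneq b 0.
  have [z z0 Az] : exists2 z : 'cV[R]_n, z != 0 & A *m z = a *: z.
    case/orP: xy => [x0 | y0]; [exists x | exists y] => //.
      by rewrite Ax b0 scale0r subr0.
    by rewrite Ay b0 scale0r add0r.
  exists 1%N, z, a%:M, [:: a%:C%C], mu; rewrite b0 in cmu *; split=> //.
  - by move: cmu; rewrite /conj_closed /= oppr0 perm_cons.
  - by left.
  - exact: row_full_cV.
  - by rewrite Az mul_mx_scalar; split=> //; exact: has_spectrum_scalar1.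
(* Since [b != 0], the conjugate differs from the head of the list, and closure puts it in the
   tail. *)
have lbar : (a -i* b)%C \in mu.
  have : (a -i* b)%C \in (a +i* b)%C :: mu.
    by rewrite -(perm_mem cmu) mem_head.
  by rewrite inE eq_complex /= eqxx /= eqNr (negPf b0).
have mu_eq := perm_to_rem lbar.
exists (1 + 1)%N, (row_mx x y : 'M_(n, 1 + 1)), (block_mx a%:M b%:M (- b)%:M a%:M : 'M_(1 + 1)),
  [:: (a +i* b)%C; (a -i* b)%C], (rem (a -i* b)%C mu); split.
- by rewrite /= perm_cons.
- apply: (@conj_closed_catr _ [:: (a +i* b)%C; (a -i* b)%C]).
    by rewrite /conj_closed /= opprK; exact: permEl (perm_catC [:: _] [:: _]).
  by apply: perm_conj_closed cmu; rewrite perm_cons.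
- by right.
- (* Applying A to s x + t y = 0 gives t x - s y = 0 because b != 0; together
     they say that s^2 + t^2 annihilates both x and y. *)
  apply: row_full_inj0 => c; rewrite -[c]vsubmxK mul_row_col.
  rewrite [usubmx c]mx11_scalar [dsubmx c]mx11_scalar !mul_mx_scalar.
  move: (usubmx c 0 0) (dsubmx c 0 0) => s t E.
  have E' : t *: x - s *: y = 0.
    have := congr1 (mulmx A) E.
    rewrite mulmxDr -!scalemxAr Ax Ay mulmx0.
    rewrite (_ : _ + _ = a *: (s *: x + t *: y) + b *: (t *: x - s *: y)).
      by rewrite E scaler0 add0r => /eqP; rewrite scaler_eq0 (negPf b0) => /eqP.
    by apply/colP => i; rewrite !mxE; ring.
  have st0 : s ^+ 2 + t ^+ 2 = 0.
    apply/eqP; case/orP: xy; apply: contraNT => st.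
      have : (s ^+ 2 + t ^+ 2) *: x = 0.
        rewrite (_ : _ *: x = s *: (s *: x + t *: y) + t *: (t *: x - s *: y)).
          by rewrite E E' !scaler0 addr0.
        by apply/colP => i; rewrite !mxE; ring.
      by move/eqP; rewrite scaler_eq0 (negPf st).
    have : (s ^+ 2 + t ^+ 2) *: y = 0.
      rewrite (_ : _ *: y = t *: (s *: x + t *: y) - s *: (t *: x - s *: y)).
        by rewrite E E' !scaler0 subr0.
      by apply/colP => i; rewrite !mxE; ring.
    by move/eqP; rewrite scaler_eq0 (negPf st).
  move/eqP: st0; rewrite paddr_eq0 ?sqr_ge0 // !sqrf_eq0 => /andP[/eqP-> /eqP->].
  by rewrite raddf0 col_mx0.
- split; last exact: has_spectrum_rotation.
  rewrite mul_mx_row Ax Ay mul_row_block !mul_mx_scalar scaleNr.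
  by rewrite [b *: x + _]addrC [in RHS]addrC; congr row_mx; rewrite addrC.
Qed.

(** Induction on the number of selected eigenvalues. The unselected ones, [rest], stay in the
    spectrum of each successive quotient [B]. *)
Lemma real_schur p n (A : 'M[R]_n) mu rest :
  size mu = p -> has_spectrum A (mu ++ rest) -> conj_closed mu ->
  exists W : 'M_(n, p), schur_vectors_for 1%:M A W mu.
Proof.
elim/ltn_ind: p n A mu => p IH n A mu size_mu specA cmu.
have [mu0 | mu_neq0] := eqVneq mu [::].
  move: size_mu; rewrite mu0 => {IH} <- /=; exists 0, 0.
    split; last by exists [::] => //; split=> // -[].
      by rewrite !mulmx0.
    by rewrite /sketch_orthonormal [LHS]flatmx0 [RHS]flatmx0.
  by rewrite /has_spectrum /char_poly det_mx00 big_nil.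
have [r [X0 [C0 [mu1 [mu2 [Emu cmu2 r12 fX0 [AX0 specC0]]]]]]] :=
  invariant_block specA cmu mu_neq0.
have [X [C [oX AX specC]]] : exists (X : 'M_(n, r)) C,
    [/\ X^T *m X = 1%:M, A *m X = X *m C & has_spectrum C mu1].
  have [G uG oX] := gram_schmidt fX0.
  have GC : C0 *m G = G *m (invmx G *m C0 *m G).
    by rewrite !mulmxA mulmxV ?mul1mx.
  exists (X0 *m G), (invmx G *m C0 *m G); split=> //.
    by rewrite -(mulmxA X0) -GC (mulmxA A) AX0 mulmxA.
  exact: eq_has_spectrum (char_poly_intertwine uG GC) specC0.
have size_mu1 := size_spectrum specC.
have rn : (r <= n)%N by rewrite -{1}(eqP fX0) rank_leq_row.
have pE : p = (r + size mu2)%N by rewrite -size_mu (perm_size Emu) size_cat size_mu1.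
rewrite pE in IH *; move: specA X AX oX {X0 fX0 AX0}.
(* The dimension is rewritten as [r + (n - r)] so that [deflation] applies. *)
rewrite -(subnKC rn) in A * => specA X AX oX.
have fX := orthonormal_row_full oX.
have [Z [N [B [XZ ZZ uXZ AZ charA]]]] := deflation fX AX.
have specB : has_spectrum B (mu2 ++ rest).
  apply/(has_spectrum_cat _ charA specC); rewrite catA.
  by apply: perm_has_spectrum specA; rewrite perm_cat2r.
have lt_mu2 : (size mu2 < r + size mu2)%N.
  by case: r12 => ->; rewrite -[X in (X < _)%N]add0n ltn_add2r.
have [W [S schurW specS]] := IH _ lt_mu2 _ B mu2 erefl specB cmu2.
exists (row_mx X (Z *m W)), (block_mx C (N *m W) 0 S).
  apply: partial_schur_lift schurW => //.
    split=> //; first by rewrite /sketch_orthonormal mul1mx.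
    exists [:: r]; last exact: block_upper_triangular1.
    by case: r12 => ->.
  by rewrite /sketch_orthonormal mul1mx; apply/gram_row.
apply: perm_has_spectrum (_ : perm_eq (mu1 ++ mu2) mu) _; first by rewrite perm_sym.
by apply/(has_spectrum_cat _ (char_poly_ublock C (N *m W) S) specC).
Qed.

End RealSchur.

(** * Deflation *)

Section Deflation.
Variable R : realType.

Lemma eigenvalue_subset_invariant n q (A : 'M[R]_n) (U : 'M_(n, q)) C s :
  row_full U -> A *m U = U *m C -> has_spectrum C s -> eigenvalue_subset A s.
Proof.
move=> fU AU specC.
have qn : (q <= n)%N by rewrite -{1}(eqP fU) rank_leq_row.
move: U fU AU; rewrite -(subnKC qn) in A * => U fU AU.
have [_ [_ [B [_ _ _ _ charA]]]] := deflation fU AU.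
have [t specB] := spectrum_exists B.
by exists t; apply/(has_spectrum_cat _ charA specC).
Qed.

(** The Schur vectors of the quotient [B] for the list [t], lifted by [Z], extend [U] to a basis of
    the subspace. *)
Lemma assoc_invariant_extension n q p (A : 'M[R]_n) (U : 'M_(n, q)) C s t :
  row_full U -> A *m U = U *m C -> has_spectrum C s ->
  size t = p -> conj_closed t -> eigenvalue_subset A (s ++ t) ->
  exists2 V, assoc_invariant_subspace A (q + p) V (s ++ t) & (colspan U <= V)%VS.
Proof.
move=> fU AU specC size_t ct [rest]; rewrite -catA => specA.
have qn : (q <= n)%N by rewrite -{1}(eqP fU) rank_leq_row.
move: U fU AU specA; rewrite -(subnKC qn) in A * => U fU AU specA.
have [Z [N [B [_ _ uUZ AZ charA]]]] := deflation fU AU.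
have specB : has_spectrum B (t ++ rest) by apply/(has_spectrum_cat _ charA specC).
have [W [S [BW oW _] specS]] := real_schur size_t specB ct.
rewrite /sketch_orthonormal mul1mx in oW.
exists (colspan (row_mx U (Z *m W))); last first.
  apply/colspan_subv; exists (col_mx 1%:M 0).
  by rewrite mul_row_col mulmx1 mulmx0 addr0.
apply: (assoc_colspan (M := block_mx C (N *m W) 0 S)).
- have -> : row_mx U (Z *m W) = row_mx U Z *m block_mx 1%:M 0 0 W.
    by rewrite mul_row_block !mulmx0 mulmx1 addr0 add0r.
  apply: row_full_mul; first by rewrite row_full_unit.
  apply/row_fullP; exists (block_mx 1%:M 0 0 W^T).
  by rewrite mulmx_block !mulmx0 !mul0mx mulmx1 !addr0 add0r oW scalar_mx_block.
- by rewrite mul_mx_row AU mul_row_block mulmx0 addr0 (mulmxA A) AZ mulmxDl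
    -!mulmxA BW.
- by apply/(has_spectrum_cat _ (char_poly_ublock C (N *m W) S) specC).
Qed.

Variables (d n : nat) (Omega : 'M[R]_(d, n)).

(** Since [1 - eps > 0], the lower bound of the embedding makes the norm of [x] vanish with that of
    its sketch. *)
Lemma eps_embedding_inj eps V x :
  0 <= eps < 1 -> eps_embedding eps Omega V -> x \in V -> Omega *m x = 0 -> x = 0.
Proof.
move=> /andP[_ eps1] emb /emb /andP[le_x _] Ox.
move: le_x; rewrite Ox {2}/sqnorm big1 ?mulr0 => [|i _]; last first.
  by rewrite mxE expr0n.
rewrite pmulr_rle0 ?subr_gt0 // => le0.
have s0 : sqnorm x = 0.
  by apply/eqP; rewrite eq_le le0 sumr_ge0 // => i _; rewrite sqr_ge0.
apply/colP => i; rewrite mxE; apply/eqP; rewrite -sqrf_eq0; apply/eqP.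
by apply: (psumr_eq0P _ s0) => // j _; rewrite sqr_ge0.
Qed.

Lemma sketch_orthonormal_row_full m (M : 'M_(n, m)) :
  sketch_orthonormal Omega M -> row_full M.
Proof.
move=> oM; apply/row_fullP; exists ((Omega *m M)^T *m Omega).
by rewrite -mulmxA.
Qed.

(** For orthonormal columns the transpose satisfies the four Penrose equations, whose solution is
    unique. *)
Lemma oblique_projE m (M : 'M_(n, m)) :
  sketch_orthonormal Omega M ->
  oblique_proj Omega M = M *m (Omega *m M)^T *m Omega.
Proof.
rewrite /sketch_orthonormal /oblique_proj => oM; congr (_ *m _ *m _).
apply: penrose_uniq (pinvP _) _; apply/and4P; split; apply/eqP.
- by rewrite -mulmxA oM mulmx1.
- by rewrite oM mul1mx.
- by rewrite trmx_mul trmxK.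
- by rewrite oM trmx1.
Qed.

Lemma oblique_projK m (M : 'M_(n, m)) :
  sketch_orthonormal Omega M -> oblique_proj Omega M *m M = M.
Proof. by move=> oM; rewrite oblique_projE // -!mulmxA oM mulmx1. Qed.

Lemma oblique_proj0 m p (M : 'M_(n, m)) (N : 'M_(n, p)) :
  sketch_orthonormal Omega M ->
  oblique_proj Omega M *m N = 0 <-> (Omega *m M)^T *m (Omega *m N) = 0.
Proof.
move=> oM; rewrite oblique_projE // -!mulmxA; split=> [|->]; last by rewrite mulmx0.
by rewrite -[X in _ = X -> _](mulmx0 _ M); apply/row_full_inj/sketch_orthonormal_row_full.
Qed.

Lemma sketch_orthonormal_row m p (M : 'M_(n, m)) (N : 'M_(n, p)) :
  sketch_orthonormal Omega (row_mx M N) <->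
  [/\ sketch_orthonormal Omega M, sketch_orthonormal Omega N
    & oblique_proj Omega M *m N = 0].
Proof.
rewrite {1}/sketch_orthonormal mul_mx_row; split.
  move=> /gram_row[oM oN MN]; split=> //; exact/oblique_proj0.
by move=> [oM oN] /oblique_proj0 MN; apply/gram_row; split=> //; exact: MN.
Qed.

Lemma has_spectrum0 q : has_spectrum (0 : 'M[R]_q) (nseq q 0).
Proof.
apply/has_spectrumE; rewrite /char_poly /char_poly_mx map_mx0 subr0 det_scalar.
rewrite big_nseq GRing.iter_mulr_1 rmorphXn /= map_polyX.
by rewrite subr0.
Qed.

(** Write [U = X E] in a basis [X] of [V], complete [E], and orthonormalize the sketches keeping [U]
    in front. The restriction of [A] to [V] becomes block triangular, and its lower right block is
    brought to real Schur form. *)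
Lemma assoc_schur_basis q p (A : 'M_n) (U : 'M_(n, q)) C V s t :
  partial_schur Omega A U C -> has_spectrum C s -> size t = p -> conj_closed t ->
  assoc_invariant_subspace A (q + p) V (s ++ t) -> (colspan U <= V)%VS ->
  (forall x, x \in V -> Omega *m x = 0 -> x = 0) ->
  exists (U2 : 'M_(n, p)) T,
    [/\ colspan (row_mx U U2) = V, partial_schur Omega A (row_mx U U2) T
      & has_spectrum T (s ++ t)].
Proof.
move=> schurU specC size_t ct [_ dimV [X [M [EV AX specM]]]] sUV injV.
have [AU oU _] := schurU.
have [E UE] : exists E, U = X *m E by apply/colspan_subv; rewrite EV.
have fX : row_full X by apply/dim_colspan; rewrite EV.
have fE : row_full E.
  have /row_fullP[L LU] := sketch_orthonormal_row_full oU.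
  by apply/row_fullP; exists (L *m X); rewrite -mulmxA -UE.
have [F [_ _ uEF]] := orthogonal_completion fE.
(* Injectivity of [Omega] on [V] keeps the sketched basis independent, as orthonormalization
   requires. *)
have fOX : row_full (Omega *m X).
  apply: row_full_inj0 => y; rewrite -mulmxA => /injV Xy0.
  apply: (row_full_inj fX); rewrite mulmx0 Xy0 // -EV; apply/colspanP.
  by exists y.
have fOUF : row_full (row_mx (Omega *m U) (Omega *m (X *m F))).
  rewrite UE -mul_mx_row -mul_mx_row mulmxA; apply: row_full_mul => //.
  by rewrite row_full_unit.
have [K [D [uD oUD]]] := orthonormal_extension oU fOUF.
(* [G] changes the basis [X] of [V] into the sketch-orthonormal basis [(U Y)]. *)
pose G := row_mx E F *m block_mx 1%:M K 0 D.
have uG : G \in unitmx by rewrite unitmx_mul uEF ublock_unit unitmx1.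
pose Y := U *m K + X *m F *m D.
have XG : X *m G = row_mx U Y.
  by rewrite /G mulmxA (mul_mx_row X) -UE mul_row_block mulmx1 mulmx0 addr0.
have oUY : sketch_orthonormal Omega (row_mx U Y).
  rewrite /sketch_orthonormal -XG /G (mulmxA X) (mul_mx_row X) -UE.
  by rewrite (mulmxA Omega) (mul_mx_row Omega); exact: oUD.
have fUY := sketch_orthonormal_row_full oUY.
pose M' := invmx G *m M *m G.
have GM : M *m G = G *m M' by rewrite /M' !mulmxA mulmxV ?mul1mx.
have AUY : A *m row_mx U Y = row_mx U Y *m M'.
  by rewrite -XG -(mulmxA X) -GM (mulmxA A) AX mulmxA.
have EM' := lsub_invariant fUY AUY AU.
have charM : char_poly M = char_poly C * char_poly (drsubmx M').
  by rewrite (char_poly_intertwine uG GM) EM' char_poly_ublock -EM'.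
(* No eigenvalue is left over: [s ++ t] is the whole spectrum of the restriction to [V]. *)
have specB : has_spectrum (drsubmx M') (t ++ [::]).
  by rewrite cats0; apply/(has_spectrum_cat _ charM specC).
have [W [S schurW specS]] := real_schur size_t specB ct.
exists (Y *m W), (block_mx C (ursubmx M' *m W) 0 S); split.
- have -> : row_mx U (Y *m W) = X *m (G *m block_mx 1%:M 0 0 W).
    by rewrite mulmxA XG mul_row_block !mulmx0 mulmx1 addr0 add0r.
  rewrite colspan_mul_unit // unitmx_mul uG ublock_unit unitmx1 /=.
  rewrite -row_full_unit; apply: orthonormal_row_full.
  by case: schurW => _; rewrite /sketch_orthonormal mul1mx.
- apply: partial_schur_lift schurW => //.
  have := congr1 rsubmx AUY; rewrite EM' mul_mx_row mul_row_block !row_mxKr.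
  by rewrite -EM'.
- by apply/(has_spectrum_cat _ (char_poly_ublock C (ursubmx M' *m W) S) specC).
Qed.

(** [I - P] annihilates [U] and fixes [U2], so only the lower right block of [T] survives and the
    eigenvalues of [C] turn into zeros. *)
Lemma deflated_schur_vectors q p (A : 'M_n) (U : 'M_(n, q)) (U2 : 'M_(n, p)) C T s t :
  A *m U = U *m C -> has_spectrum C s ->
  partial_schur Omega A (row_mx U U2) T -> has_spectrum T (s ++ t) ->
  schur_vectors_for Omega ((1%:M - oblique_proj Omega U) *m A) (row_mx U U2)
    (nseq q 0 ++ t).
Proof.
move=> AU specC [AUU oUU [sh bsh [ssh Tsh]]] specT.
have fUU := sketch_orthonormal_row_full oUU.
have [oU oU2 PU2] := (sketch_orthonormal_row _ _).1 oUU.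
have ET := lsub_invariant fUU AUU AU.
have charT : char_poly T = char_poly C * char_poly (drsubmx T).
  by rewrite {1}ET char_poly_ublock.
exists (block_mx 0 0 0 (drsubmx T)).
  split=> //.
    rewrite -mulmxA AUU mulmxA mulmxBl mul1mx mul_mx_row oblique_projK // PU2.
    rewrite opp_row_mx add_row_mx subrr oppr0 addr0 {1}ET !mul_row_block.
    by rewrite !mul0mx !mulmx0 !add0r.
  (* The same partition works, because each entry of the new matrix is zero or an entry of [T]. *)
  exists sh => //; split=> // i j /Tsh; rewrite {1}ET.
  rewrite -(splitK i) -(splitK j).
  case: (split i) => i'; case: (split j) => j' /=.
  - by move=> _; rewrite block_mxEul mxE.
  - by move=> _; rewrite block_mxEur mxE.
  - by move=> _; rewrite block_mxEdl mxE.
  - by rewrite !block_mxEdr.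
apply/(has_spectrum_cat _ (char_poly_ublock 0 0 (drsubmx T)) (has_spectrum0 q)).
by apply/(has_spectrum_cat _ charT specC).
Qed.

(** Once [P W = 0], the joint family is sketch-orthonormal, and [A W = P A W + W S] shows that [A]
    acts on it in block triangular form. *)
Lemma lifted_schur_vectors q r (A : 'M_n) (U : 'M_(n, q)) (W : 'M_(n, r)) C s :
  partial_schur Omega A U C ->
  schur_vectors_for Omega ((1%:M - oblique_proj Omega U) *m A) W s -> 0 \notin s ->
  schur_vectors Omega A (row_mx U W).
Proof.
move=> schurU [S [AW oW [sh bsh tsh]] specS] s0.
have [AU oU _] := schurU; pose P := oblique_proj Omega U.
(* Up to sign, [det S] is the value at 0 of the characteristic polynomial. *)
have uS : S \in unitmx.
  rewrite unitmxE unitfE; apply: contra s0 => /eqP detS.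
  rewrite -root_prod_XsubC -specS /root horner_coef0 char_poly_det det_map_mx detS.
  by rewrite rmorph0 mulr0.
have PP : P *m P = P by rewrite {2 3}/P oblique_projE // !mulmxA oblique_projK.
have PW : P *m W = 0.
  have -> : W = (1%:M - P) *m A *m W *m invmx S by rewrite AW mulmxK.
  by rewrite !mulmxA mulmxBr mulmx1 PP subrr !mul0mx.
have AWE : A *m W = U *m ((Omega *m U)^T *m Omega *m (A *m W)) + W *m S.
  by rewrite -AW oblique_projE // -!mulmxA mulmxBl mul1mx -!mulmxA addrC subrK.
exists (block_mx C ((Omega *m U)^T *m Omega *m (A *m W) *m 1%:M) 0 S).
(* [S] is already block triangular, so the identity serves as its Schur basis. *)
rewrite -[W in row_mx U W]mulmx1; apply: partial_schur_lift AWE _ _ => //.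
  exact/sketch_orthonormal_row.
split; first by rewrite mulmx1 mul1mx.
  by rewrite /sketch_orthonormal !mulmx1 trmx1.
by exists sh.
Qed.

End Deflation.

(* The order of the factorization is k = q + p. *)
Theorem theorem4p1 (R : realType) (d n q p : nat) (eps : R)
  (Omega : 'M[R]_(d, n)) (A : 'M[R]_n)
  (Uq : 'M[R]_(n, q)) (Ut : 'M[R]_(n, p)) (u : 'cV[R]_n)
  (Tqq : 'M[R]_q) (Tqt : 'M[R]_(q, p)) (Tt : 'M[R]_p)
  (bq : 'cV[R]_q) (bt : 'cV[R]_p)
  (shq sht : seq nat) (lam : seq R[i])
  (q_gt0 : (0 < q)%N) (p_gt0 : (0 < p)%N)
  (eps_itv : 0 <= eps < 1)
  (ks : krylov_schur Omega A (shq ++ sht) (row_mx Uq Ut)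
          (block_mx Tqq Tqt 0 Tt) u (col_mx bq bt))
  (no_split : sumn shq = q)
  (embU : eps_embedding eps Omega (colspan (row_mx (row_mx Uq Ut) u)))
  (specTqq : has_spectrum Tqq lam)
  (bq0 : bq = 0) :
  let P := oblique_proj Omega Uq in
  let Aq := (1%:M - P) *m A in
  [/\
   (* the projector and the deflated decomposition *)
      [/\ P *m P = P, colspan P = colspan Uq &
          (1%:M - P) *m A *m Ut = Ut *m Tt + u *m bt^T],
   (* item 1 *)
      [/\ forall l, l \in lam -> eigenvalue (complexify A) l,
          eigenvalue_subset A lam,
          partial_schur Omega A Uq Tqq &
          assoc_invariant_subspace A q (colspan Uq) lam],
   (* item 2 *)
      forall mu : seq R[i], size mu = p ->
        conj_closed (lam ++ mu) -> eigenvalue_subset A (lam ++ mu) ->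
        [/\ exists2 V, assoc_invariant_subspace A (q + p) V (lam ++ mu) &
                       (colspan Uq <= V)%VS,
            forall V, assoc_invariant_subspace A (q + p) V (lam ++ mu) ->
              (colspan Uq <= V)%VS -> eps_embedding eps Omega V ->
              exists (U2 : 'M[R]_(n, p)) (T' : 'M[R]_(q + p)),
                [/\ colspan (row_mx Uq U2) = V,
                    partial_schur Omega A (row_mx Uq U2) T' &
                    has_spectrum T' (lam ++ mu)] &
            forall (U2 : 'M[R]_(n, p)) (T' : 'M[R]_(q + p)),
              partial_schur Omega A (row_mx Uq U2) T' ->
              has_spectrum T' (lam ++ mu) ->
              schur_vectors_for Omega Aq (row_mx Uq U2) (nseq q 0 ++ mu)] &
   (* item 3 *)
      forall (r : nat) (Ur : 'M[R]_(n, r)) (s : seq R[i]), (r <= p)%N ->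
        schur_vectors_for Omega Aq Ur s -> 0 \notin s ->
        schur_vectors Omega A (row_mx Uq Ur) /\
        invariant_under A (colspan (row_mx Uq Ur))].
Proof.
move=> P Aq; subst bq.
case: ks => AU _ bsh tsh _ oUu _.
have [oU _ _] := (sketch_orthonormal_row _ _ _).1 oUu.
have [oUq oUt PUt] := (sketch_orthonormal_row _ _ _).1 oU.
have fUq := sketch_orthonormal_row_full oUq.
(* The sketch of [u] is orthogonal to those of all columns of [(Uq Ut)], in particular of [Uq]. *)
have Pu : P *m u = 0.
  apply/oblique_proj0 => //; move: oUu; rewrite /sketch_orthonormal.
  rewrite (mul_mx_row _ (row_mx Uq Ut)) => /gram_row[_ _].
  rewrite (mul_mx_row _ Uq) tr_row_mx mul_col_mx => UU0.
  by have := congr1 usubmx UU0; rewrite col_mxKu linear0.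
(* The zero block of [b] removes [u] from the first block column, which leaves [A Uq = Uq Tqq]. *)
move: AU; rewrite mul_mx_row mul_row_block tr_col_mx mul_mx_row add_row_mx.
rewrite trmx0 !mulmx0 !addr0 => /eq_row_mx[AUq AUt].
have PUq : P *m Uq = Uq by exact: oblique_projK.
have schurUq : partial_schur Omega A Uq Tqq.
  split=> //; exists shq; last exact: block_upper_triangular_ul tsh.
  by move: bsh; rewrite /blocks_upto2 all_cat => /andP[].
have subA := eigenvalue_subset_invariant fUq AUq specTqq.
split.
- split.
  + by rewrite {2}/P oblique_projE // !mulmxA PUq -oblique_projE.
  + apply: subv_anti; apply/andP; split; apply/colspan_subv; last by exists Uq.
    by exists ((Omega *m Uq)^T *m Omega); rewrite /P oblique_projE // mulmxA.
  (* [I - P] removes [Uq Tqt] and fixes both [Ut] and [u]. *)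
  + rewrite -mulmxA AUt mulmxBl mul1mx !mulmxDr !mulmxA PUq PUt Pu.
    by rewrite !mul0mx !addr0 addrC !addrA addNr add0r.
- split=> //; last exact: assoc_colspan AUq specTqq.
  move=> l llam; have [s specA] := subA.
  by rewrite eigenvalue_root_char specA root_prod_XsubC mem_cat llam.
- move=> mu size_mu clm subAlm.
  (* As the spectrum of a real matrix, [lam] is closed under conjugation, hence so is [mu]. *)
  have cmu := conj_closed_catr (conj_closed_spectrum specTqq) clm.
  split.
  + exact: assoc_invariant_extension AUq specTqq _ _ _.
  + move=> V assocV sUV embV; apply: (assoc_schur_basis schurUq specTqq) assocV sUV _ => //.
    by move=> x; exact: eps_embedding_inj eps_itv embV.
  + by move=> U2 T'; exact: deflated_schur_vectors AUq specTqq.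
- move=> r Ur s _ schurUr s0.
  have [S schurS] := lifted_schur_vectors schurUq schurUr s0.
  split; first by exists S.
  by have [AS _ _] := schurS; exact: invariant_colspan AS.
Qed.
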